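(* For an integer $t\ge 1$, let the T-graph$(t)$ be the tree obtained from a single edge (two vertices joined by an edge) by applying the $(1,1)$-star-fractal operation $t$ times, and let $\mathcal{S}_{t}$ be its geodesic distance. Then $$\mathcal{S}_{t}=3^{t}+\frac{2^{t+2}+5}{5}\times 3^{2t-1}-\frac{3^{t+1}}{5}.$$
   Context: The geodesic distance of a finite connected graph $\mathcal{G}$ with vertex set $\mathcal{V}$ is the total $\mathcal{S}=\sum_{\{u,v\}} d_{uv}$, summed over all unordered pairs of distinct vertices $u,v\in\mathcal{V}$, where $d_{uv}$ is the number of edges of a shortest path joining $u$ and $v$. The $(1,1)$-star-fractal operation on a graph does the following to every edge $uv$: it inserts a new vertex $w$ into the edge (replacing $uv$ by the path $uwv$), and attaches one further new vertex $w_1$ to $w$ by an edge (all new vertices distinct for distinct edges). Applying the operation $t$ times means iterating: each application acts on every edge of the graph produced by the previous application. *)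

(* Defs.v *)
From mathcomp Require Import all_boot.

Set Implicit Arguments.
Unset Strict Implicit.
Unset Printing Implicit Defensive.

Record sgraph := SGraph {
  vertex :> finType;
  adj : rel vertex;
  adj_sym : symmetric adj;
  adj_irr : irreflexive adj
}.

Definition is_edge (G : sgraph) (e : {set G}) : bool :=
  [exists u, exists v, adj u v && (e == [set u; v])].

Definition edge (G : sgraph) : finType := {e : {set G} | is_edge e}.

Definition connected_graph (G : sgraph) : Prop :=
  forall u v : G, connect (@adj G) u v.

Definition has_walk (G : sgraph) (u v : G) (n : nat) : bool :=
  [exists p : n.-tuple G, path (@adj G) u p && (last u p == v)].

(* The least n such that a walk with n edges joins u to v. A shortest walk
   repeats no vertex, so n < #|G| suffices; the value is #|G| when no walk
   joins u to v. *)
Definition dist (G : sgraph) (u v : G) : nat :=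
  find (has_walk u v) (iota 0 #|G|).

(* Comparing positions in the enumeration of the vertices selects each
   unordered pair of distinct vertices exactly once. *)
Definition geodesic_distance (G : sgraph) : nat :=
  \sum_(u : G) \sum_(v : G | enum_rank u < enum_rank v) dist u v.

(* [inl (inl u)] is an old vertex, [inl (inr e)] the vertex inserted into the
   edge e, and [inr e] the pendant vertex attached to [inl (inr e)]. *)
Definition star_vertex (G : sgraph) : finType := (G + edge G + edge G)%type.

Definition star_adj (G : sgraph) (x y : star_vertex G) : bool :=
  match x, y with
  | inl (inl u), inl (inr e) | inl (inr e), inl (inl u) => u \in val e
  | inl (inr e), inr f | inr f, inl (inr e) => e == f
  | _, _ => false
  end.

Lemma star_adj_sym (G : sgraph) : symmetric (@star_adj G).
Proof. by move=> [[u|e]|e] [[v|f]|f]. Qed.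

Lemma star_adj_irr (G : sgraph) : irreflexive (@star_adj G).
Proof. by move=> [[u|e]|e]. Qed.

Definition star_fractal (G : sgraph) : sgraph :=
  SGraph (@star_adj_sym G) (@star_adj_irr G).

Definition edge_adj (x y : bool) : bool := x != y.

Lemma edge_adj_sym : symmetric edge_adj.
Proof. by case=> [] []. Qed.

Lemma edge_adj_irr : irreflexive edge_adj.
Proof. by case. Qed.

Definition single_edge : sgraph := SGraph edge_adj_sym edge_adj_irr.

Definition T_graph (t : nat) : sgraph := iter t star_fractal single_edge.

Lemma dist_min (G : sgraph) (u : G) (p : seq G) :
  path (@adj G) u p -> dist u (last u p) <= size p.
Proof.
move=> pth; case/shortenP: (pth) => q qth uq sq.
have szq : size q < #|G|.
  by have := max_card [in u :: q]; rewrite (card_uniqP uq).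
have szqp : size q <= size p.
  by apply: uniq_leq_size => //; case/andP: uq.
apply: leq_trans szqp; rewrite leqNgt; apply/negP => /(before_find 0).
rewrite nth_iota // add0n => /negbT/existsP[].
by exists (in_tuple q); rewrite qth eqxx.
Qed.

Lemma dist_path (G : sgraph) (u v : G) : connect (@adj G) u v ->
  exists p, [/\ path (@adj G) u p, last u p = v & size p = dist u v].
Proof.
move=> /connectP[p0 /shortenP[q qth uq _] ->].
have szq : size q < #|G|.
  by have := max_card [in u :: q]; rewrite (card_uniqP uq).
have hw : has (has_walk u (last u q)) (iota 0 #|G|).
  apply/hasP; exists (size q); first by rewrite mem_iota.
  by apply/existsP; exists (in_tuple q); rewrite qth eqxx.
have := nth_find 0 hw; rewrite nth_iota; last by rewrite -[X in _ < X](size_iota 0) -has_find.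
rewrite add0n => /existsP[p /andP[pth /eqP lp]].
by exists p; rewrite size_tuple.
Qed.

Lemma star_fractal_connected (G : sgraph) :
  connected_graph G -> connected_graph (star_fractal G).
Proof.
move=> cG.
have csym : connect_sym (@adj (star_fractal G)).
  exact/sym_connect_sym/adj_sym.
have old u v : connect (@adj (star_fractal G)) (inl (inl u)) (inl (inl v)).
  case/connectP: (cG u v) => p; elim: p u => [|w p IH] u /=; first by move=> _ ->.
  case/andP=> uw pth lst; apply: connect_trans (IH _ pth lst).
  have ew : is_edge [set u; w].
    by apply/existsP; exists u; apply/existsP; exists w; rewrite uw eqxx.
  apply: (@connect_trans _ _ (inl (inr (Sub [set u; w] ew)))); apply: connect1;
    by rewrite /= !inE eqxx ?orbT.
have toold x : exists u, connect (@adj (star_fractal G)) x (inl (inl u)).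
  have mid (e : edge G) : exists u,
      connect (@adj (star_fractal G)) (inl (inr e)) (inl (inl u)).
    case/existsP: (valP e) => u /existsP[v /andP[_ /eqP ee]]; exists u.
    by apply: connect1; rewrite /= ee !inE eqxx.
  case: x => [[u|e]|e]; [by exists u|exact: mid|].
  have [u eu] := mid e; exists u; apply: connect_trans eu.
  by apply: connect1; rewrite /= eqxx.
move=> x y; have [u xu] := toold x; have [v yv] := toold y.
apply: connect_trans xu _; apply: connect_trans (old u v) _.
by rewrite csym.
Qed.

Lemma T_graph_connected (t : nat) : connected_graph (T_graph t).
Proof.
elim: t => [|t IH]; last exact: star_fractal_connected.
by move=> x y; case: (eqVneq x y) => [->//|xy]; apply: connect1.
Qed.

(* Main.v *)
Require Import Defs.
From mathcomp Require Import all_boot all_order all_algebra.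
From mathcomp Require Import zify lra.

(** Write S for the geodesic distance, n and m for the numbers of vertices and
    edges. The formula comes from a recurrence relating S of a tree to S of its
    star-fractal, which is again a tree.

    In a tree rooted at w, sending each vertex other than w to the edge towards
    its parent is a bijection onto the edges. Hence every edge joins a vertex
    to its parent ([tree_adj]), and summing the distances to w over the two
    ends of all edges counts every vertex at distance d > 0 with weight
    d + (d - 1) ([tree_edge_sum]).

    In the star-fractal, old distances double ([dist_old]); a pendant vertex is
    one step further than the inserted vertex it hangs from ([dist_pend]); and
    an inserted vertex is at a distance from the rest which is the average of
    the distances of the two ends of its edge ([dist_mid]). With these, all the
    sums of distances between the three kinds of vertices reduce, through
    [tree_edge_sum], to S, n and m. Using n = m + 1, the result is
    S' = 18 S - 3 m^2 - 6 m ([geodesic_distance_star]), and m = 3^t for the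
    T-graph, so that 15 S = 6 * 3^t + (4 * 2^t + 5) * 9^t by induction on t. *)

Set Implicit Arguments.
Unset Strict Implicit.
Unset Printing Implicit Defensive.

Local Open Scope nat_scope.

(** * Distances in a connected graph *)

Lemma distxx (G : sgraph) (u : G) : dist u u = 0.
Proof. by have := @dist_min G u [::] isT; rewrite leqn0 => /eqP. Qed.

(** A function that varies by at most k along edges varies by at most k times
    the distance. This gives both bounds needed to identify a distance: k = 1
    bounds it below, and a larger k compares two graphs. *)
Lemma dist_lipschitz (G : sgraph) (k : nat) (f : G -> nat) :
    connected_graph G -> (forall x y, adj x y -> f x <= k + f y) ->
  forall u v, f u <= k * dist u v + f v.
Proof.
move=> cG fk u v; have [p [+ <- <-]] := dist_path (cG u v).
elim: p u => [|w p IH] u /=; first by rewrite muln0.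
by case/andP=> /fk uw /IH wp; lia.
Qed.

Lemma distC (G : sgraph) : connected_graph G ->
  forall u v : G, dist u v = dist v u.
Proof.
move=> cG; suff le (u v : G) : dist u v <= dist v u by move=> u v; apply/eqP; rewrite eqn_leq !le.
have [p [pth <- <-]] := dist_path (cG v u).
have -> : dist (last v p) v = dist (last v p) (last (last v p) (rev (belast v p))).
  by case: p {pth} => //= w p; rewrite rev_cons last_rcons.
rewrite -(size_belast v) -size_rev; apply: dist_min.
by rewrite rev_path (eq_path (e' := @adj G)) // => x y; rewrite adj_sym.
Qed.

Lemma dist_triangle (G : sgraph) : connected_graph G ->
  forall u v w : G, dist u w <= dist u v + dist v w.
Proof.
move=> cG u v w.
have [p [pp <- <-]] := dist_path (cG u v).
have [q [qq <- <-]] := dist_path (cG (last u p) w).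
by rewrite -size_cat -last_cat dist_min // cat_path pp.
Qed.

Lemma dist_eq0 (G : sgraph) : connected_graph G ->
  forall u v : G, (dist u v == 0) = (u == v).
Proof.
move=> cG u v; apply/eqP/eqP => [d0|->]; last exact: distxx.
by have [[|x p] [_ /= lp]] := dist_path (cG u v); rewrite ?d0.
Qed.

Lemma dist_adj (G : sgraph) (u v : G) : adj u v -> dist u v <= 1.
Proof. by move=> uv; apply: (@dist_min G u [:: v]); rewrite /= uv. Qed.

Lemma dist_adj_le (G : sgraph) : connected_graph G ->
  forall u v w : G, adj u v -> dist u w <= (dist v w).+1.
Proof. by move=> cG u v w /dist_adj uv; have := dist_triangle cG u v w; lia. Qed.

(** Ordered pairs count every unordered pair twice, and they make exchanging
    and splitting the sums possible. *)
Lemma dist_total (G : sgraph) : connected_graph G ->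
  \sum_(u : G) \sum_(v : G) dist u v = 2 * geodesic_distance G.
Proof.
move=> cG.
have swap : geodesic_distance G =
    \sum_(u : G) \sum_(v : G | enum_rank v < enum_rank u) dist v u.
  by rewrite /geodesic_distance (exchange_big_dep predT).
rewrite mul2n -addnn {2}swap -big_split; apply: eq_bigr => u _ /=.
rewrite (bigID (fun v => enum_rank u < enum_rank v)) /=; congr (_ + _).
rewrite (bigD1 u) ?ltnn //= distxx add0n.
apply: eq_big => [v|v _]; last exact: distC.
by rewrite -leqNgt [in RHS]ltn_neqAle andbC (inj_eq val_inj) (inj_eq enum_rank_inj).
Qed.

(** * Trees *)

(** The counting form of being a tree: connectivity forces at least #|G| - 1
    edges, so this bound says that there are no more. It passes to the
    star-fractal by counting alone. *)
Definition is_tree (G : sgraph) : Prop :=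
  connected_graph G /\ #|edge G| < #|G|.

(** A neighbour of u one step closer to the root w; it exists when u != w in a
    connected graph, and the default u is of use only at the root. *)
Definition parent (G : sgraph) (w u : G) : G :=
  odflt u [pick v | adj u v && ((dist v w).+1 == dist u w)].

Lemma parentP (G : sgraph) : connected_graph G -> forall w u : G, u != w ->
  adj u (parent w u) /\ (dist (parent w u) w).+1 = dist u w.
Proof.
move=> cG w u uw; rewrite /parent; case: pickP => [v /andP[? /eqP]|none] //=.
have [[|v p] [/= pth lw sz]] := dist_path (cG u w); first by rewrite lw eqxx in uw.
have /andP[uv pth'] := pth; have := none v; rewrite uv /= eqn_leq dist_adj_le // -sz ltnS andbT.
by rewrite -lw dist_min.
Qed.

Lemma is_edge_adj (G : sgraph) (u v : G) : adj u v -> is_edge [set u; v].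
Proof.
by move=> uv; apply/existsP; exists u; apply/existsP; exists v; rewrite uv eqxx.
Qed.

Lemma edgeP (G : sgraph) (e : edge G) :
  exists u v, [/\ adj u v, u != v & val e = [set u; v]].
Proof.
have /existsP[u /existsP[v /andP[uv /eqP ->]]] := valP e; exists u, v; split=> //.
by apply: contraTneq uv => ->; rewrite adj_irr.
Qed.

(** Two vertices sharing the edge towards their parents would be each other's
    parent, each strictly closer to the root than the other. *)
Lemma parent_edge_inj (G : sgraph) : connected_graph G -> forall w : G,
  {in predC1 w &, injective (fun u => [set u; parent w u])}.
Proof.
move=> cG w u v; rewrite !inE => uw vw euv.
have [_ du] := parentP cG uw; have [_ dv] := parentP cG vw.
have: u \in [set v; parent w v] by rewrite -euv !inE eqxx.
have: v \in [set u; parent w u] by rewrite euv !inE eqxx.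
rewrite !inE => /orP[/eqP->//|/eqP vE] /orP[/eqP//|/eqP uE].
by move: du dv; rewrite -vE -uE; lia.
Qed.

(** There are #|G| - 1 non-root vertices, so the injection of
    [parent_edge_inj] exhausts the edges of a tree. *)
Lemma tree_edges (G : sgraph) : is_tree G -> forall w : G,
  [set e : {set G} | is_edge e] = [set [set u; parent w u] | u in predC1 w].
Proof.
move=> [cG mn] w; apply/esym/eqP; rewrite eqEcard; apply/andP; split.
  apply/subsetP => _ /imsetP[u uw ->]; rewrite inE is_edge_adj //.
  by have [] := parentP cG uw.
rewrite (card_in_imset (parent_edge_inj cG (w := w))) cardC1 cardsE -card_sig.
by rewrite -ltnS prednK //; apply: leq_ltn_trans mn.
Qed.

Lemma card_tree (G : sgraph) (w : G) : is_tree G -> #|G| = #|edge G|.+1.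
Proof.
move=> tG; rewrite card_sig -[#|[pred x | _]|]cardsE (tree_edges tG w).
rewrite (card_in_imset (parent_edge_inj (proj1 tG) (w := w))) cardC1 prednK //.
by apply/card_gt0P; exists w.
Qed.

Lemma tree_adj (G : sgraph) : is_tree G -> forall w u v : G, adj u v ->
  (u != w /\ v = parent w u) \/ (v != w /\ u = parent w v).
Proof.
move=> tG w u v uv; have nuv : u != v by apply: contraTneq uv => ->; rewrite adj_irr.
have: [set u; v] \in [set e : {set G} | is_edge e] by rewrite inE is_edge_adj.
rewrite (tree_edges tG w) => /imsetP[x xw euv].
have: u \in [set x; parent w x] by rewrite -euv !inE eqxx.
have: v \in [set x; parent w x] by rewrite -euv !inE eqxx orbT.
rewrite inE in xw; rewrite !inE => /orP[]/eqP vE /orP[]/eqP uE.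
- by rewrite uE vE eqxx in nuv.
- by right; rewrite vE.
- by left; rewrite uE.
- by rewrite uE vE eqxx in nuv.
Qed.

(** Reindex the edges by the non-root vertices: the edge from u to its parent
    contributes d + (d - 1), where d is the distance from u to w. *)
Lemma tree_edge_sum (G : sgraph) : is_tree G -> forall w : G,
  \sum_(e : edge G) \sum_(v in val e) dist v w + #|edge G| =
  2 * \sum_(v : G) dist v w.
Proof.
move=> tG; have [cG _] := tG; move=> w.
rewrite -(@big_sub _ _ _ _ (@is_edge G) (fun e => \sum_(v in e) dist v w)) /=.
rewrite -(eq_bigl _ _ (in_set (@is_edge G))) (tree_edges tG w).
rewrite (big_imset _ (parent_edge_inj cG (w := w))) /=.
have -> : #|edge G| = \sum_(u in predC1 w) 1.
  by rewrite sum1_card cardC1 (card_tree w tG).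
rewrite -big_split /= [in RHS](bigD1 w) //= distxx add0n big_distrr /=.
apply: eq_bigr => u uw; have [uv duv] := parentP cG uw.
have nuv : u != parent w u by apply: contraTneq uv => <-; rewrite adj_irr.
by rewrite big_setU1 ?inE //= big_set1; lia.
Qed.

(** Only one neighbour of u is closer to the root, because the edge from u to
    any other neighbour v must be the edge from v to its parent. *)
Lemma tree_dist_child (G : sgraph) : is_tree G -> forall w u v : G,
  adj u v -> v != parent w u -> dist v w = (dist u w).+1.
Proof.
move=> tG w u v uv nvp; have [cG _] := tG.
have [[_ vE]|[vw ->]] := tree_adj tG w uv; first by rewrite vE eqxx in nvp.
by have [_ <-] := parentP cG vw.
Qed.

Lemma sum_edge (G : sgraph) (F : G -> nat) (e : edge G) (u v : G) :
  u != v -> val e = [set u; v] -> \sum_(x in val e) F x = F u + F v.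
Proof. by move=> uv ->; rewrite big_setU1 ?inE //= big_set1. Qed.

(** * The star-fractal operation *)

Definition old (G : sgraph) (u : G) : star_fractal G := inl (inl u).
Definition mid (G : sgraph) (e : edge G) : star_fractal G := inl (inr e).
Definition pend (G : sgraph) (e : edge G) : star_fractal G := inr e.

Lemma sum_star (G : sgraph) (F : star_fractal G -> nat) :
  \sum_x F x = \sum_u F (old u) + \sum_e F (mid e) + \sum_e F (pend e).
Proof. by rewrite [LHS]big_sumType big_sumType. Qed.

Lemma card_star (G : sgraph) : #|star_fractal G| = #|G| + 2 * #|edge G|.
Proof. by rewrite !card_sum mul2n -addnn addnA. Qed.

Lemma card_incident (G : sgraph) :
  #|[set p : G * edge G | p.1 \in val p.2]| = 2 * #|edge G|.
Proof.
rewrite cardsE -sum1_card /=.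
rewrite -(pair_big_dep xpredT (fun u (e : edge G) => u \in val e) (fun _ _ => 1)) /=.
rewrite (exchange_big_dep xpredT) //= mulnC -sum_nat_const.
apply: eq_bigr => e _; have [u [v [_ uv eE]]] := edgeP e.
by rewrite sum1_card eE cards2 uv.
Qed.

(** The edges of the star-fractal are two halves of each old edge and one
    spike for each old edge. *)
Lemma star_edges_le (G : sgraph) : #|edge (star_fractal G)| <= 3 * #|edge G|.
Proof.
rewrite card_sig -[#|[pred x | _]|]cardsE.
pose halves := [set [set old p.1; mid p.2] | p in [set p : G * edge G | p.1 \in val p.2]].
pose spikes := [set [set mid e; pend e] | e in [set: edge G]].
have cover : [set e | is_edge e] \subset halves :|: spikes.
  have half (u : G) (e : edge G) : u \in val e -> [set old u; mid e] \in halves :|: spikes.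
    by move=> ue; rewrite inE (imset_f _ (x := (u, e))) ?inE.
  have spike (e : edge G) : [set mid e; pend e] \in halves :|: spikes.
    by rewrite inE (imset_f (fun e => [set mid e; pend e])) ?orbT ?inE.
  apply/subsetP => e'; rewrite inE => /existsP[x /existsP[y /andP[+ /eqP ->]]].
  case: x y => [[u|e]|e] [[v|f]|f] //=; do ?[exact: half | move/eqP->; exact: spike].
  - by rewrite setUC; exact: half.
  - by move/eqP->; rewrite setUC; exact: spike.
apply: leq_trans (subset_leq_card cover) _; apply: leq_trans (leq_card_setU _ _) _.
rewrite mulSn addnC leq_add //; last first.
  by rewrite -card_incident; apply: leq_imset_card.
by apply: leq_trans (leq_imset_card _ _) _; rewrite cardsT.
Qed.

Lemma star_tree (G : sgraph) : is_tree G -> is_tree (star_fractal G).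
Proof.
move=> [cG mn]; split; first exact: star_fractal_connected.
by rewrite card_star; have := star_edges_le G; lia.
Qed.

(** Subdividing doubles distances. The lower bound holds because the function
    2 d(., v) on old vertices extends to a 1-Lipschitz function on the
    star-fractal. *)
Lemma dist_old (G : sgraph) : connected_graph G ->
  forall u v : G, dist (old u) (old v) = 2 * dist u v.
Proof.
move=> cG u v; have cH := star_fractal_connected cG.
apply/eqP; rewrite eqn_leq; apply/andP; split.
  (* Adjacent old vertices are two steps apart, through the inserted one. *)
  have := @dist_lipschitz _ 2 (fun x => dist (old x) (old v)) cG _ u v.
  rewrite /= distxx addn0; apply=> x y xy.
  apply: leq_trans (dist_triangle cH _ (old y) _) _; rewrite leq_add2r.
  pose e : edge G := Sub [set x; y] (is_edge_adj xy).
  have := @dist_min _ (old x) [:: mid e; old y].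
  by rewrite /= !inE !eqxx orbT; apply.
(* The ends of e differ by at most one in distance to v, so their sum differs
   by at most one from twice either of them. *)
pose f (x : star_fractal G) := match x with
  | inl (inl u) => 2 * dist u v
  | inl (inr e) | inr e => \sum_(c in val e) dist c v
  end.
have near (x : G) (e : edge G) : x \in val e ->
    2 * dist x v <= 1 + \sum_(c in val e) dist c v /\
    \sum_(c in val e) dist c v <= 1 + 2 * dist x v.
  have [a [b [ab nab eE]]] := edgeP e; rewrite (sum_edge _ nab eE) eE.
  have := dist_adj_le cG v ab; rewrite adj_sym in ab.
  by have := dist_adj_le cG v ab; rewrite !inE => ? ? /orP[]/eqP->; lia.
have := @dist_lipschitz _ 1 f cH _ (old u) (old v); rewrite /= distxx muln0 addn0 mul1n.
by apply; case=> [[x|e]|e] [[y|e']|e'] //= => [/near[]|/near[]|/eqP->|/eqP->] //; lia.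
Qed.

(** The only neighbour of a pendant vertex is the inserted vertex, which is
    therefore its parent for every other root. *)
Lemma dist_pend (G : sgraph) : connected_graph G -> forall (f : edge G) x,
  x != pend f -> dist (pend f) x = (dist (mid f) x).+1.
Proof.
move=> cG f x xf; rewrite eq_sym in xf.
have [+ <-] := parentP (star_fractal_connected cG) xf.
by case: (parent x _) => [[u|e]|e] //= /eqP->.
Qed.

(** Seen from x, one end of f is the parent of the inserted vertex and the
    other end is a child, so their distances are d - 1 and d + 1, where d is
    that of the inserted vertex. When x is the inserted vertex itself both are
    1 while d = 0, hence the correction. *)
Lemma dist_mid (G : sgraph) : is_tree G -> forall (f : edge G) x,
  x != pend f ->
  2 * dist (mid f) x + 2 * (x == mid f) = \sum_(c in val f) dist (old c) x.
Proof.
move=> tG f x xf; have [cG _] := tG; have tH := star_tree tG; have [cH _] := tH.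
have [a [b [_ ab fE]]] := edgeP f; rewrite (sum_edge _ ab fE).
have [af bf] : adj (mid f) (old a) /\ adj (mid f) (old b).
  by rewrite /= fE !inE !eqxx orbT.
have [xm|xm] := eqVneq x (mid f).
  have one (c : G) : adj (mid f) (old c) -> dist (old c) x = 1.
    move=> mc; apply/eqP; rewrite eqn_leq lt0n dist_eq0 // xm andbT.
    by apply: dist_adj; rewrite adj_sym.
  by rewrite xm distxx -xm !one.
have := xm; rewrite eq_sym => /(parentP cH)[mp dp].
have := tree_dist_child tH af (w := x); have := tree_dist_child tH bf (w := x).
have := dist_pend cG xf.
case: (parent x (mid f)) mp dp => [[c|e]|e] //=; last by move/eqP<-; rewrite -/(pend f); lia.
rewrite fE !inE => /orP[]/eqP-> dp _ db da.
- have := db _; rewrite (inj_eq (@inl_inj _ _)) (inj_eq (@inl_inj _ _)) eq_sym ab => /(_ isT).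
  by rewrite -/(old a) in dp *; lia.
- have := da _; rewrite (inj_eq (@inl_inj _ _)) (inj_eq (@inl_inj _ _)) ab => /(_ isT).
  by rewrite -/(old b) in dp *; lia.
Qed.

(** * Sums of distances in the star-fractal *)

(** By [dist_mid] and [dist_old], an inserted vertex is at a distance from an
    old vertex u which is the sum of the distances from u, before the
    operation, to the ends of its edge; [tree_edge_sum] adds these up. *)
Lemma row_mid_sum (G : sgraph) : is_tree G -> forall u : G,
  \sum_f dist (mid f) (old u) + #|edge G| = 2 * \sum_v dist v u.
Proof.
move=> tG u; rewrite -tree_edge_sum //; congr (_ + _); apply: eq_bigr => f _.
apply/eqP; rewrite -(eqn_pmul2l (isT : 0 < 2)) -[X in X == _]addn0.
have := @dist_mid _ tG f (old u) isT; rewrite /= muln0 => ->.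
by rewrite big_distrr; apply/eqP/eq_bigr => c _; rewrite (dist_old (proj1 tG)).
Qed.

(** Pendant vertices repeat the contribution of the inserted ones, plus one
    for each edge. *)
Lemma row_star (G : sgraph) : connected_graph G -> forall x : star_fractal G,
    (forall f, x != pend f) ->
  \sum_y dist y x =
  \sum_u dist (old u) x + 2 * \sum_f dist (mid f) x + #|edge G|.
Proof.
move=> cG x xp; suff pE : \sum_f dist (pend f) x = \sum_f dist (mid f) x + #|edge G|.
  by rewrite sum_star pE; lia.
rewrite -sum1_card -big_split; apply: eq_bigr => f _ /=.
by rewrite dist_pend // addn1.
Qed.

(** Moving the root from an inserted vertex to its pendant vertex adds one to
    all distances except that of the pendant vertex, which drops from 1 to
    0. *)
Lemma row_pend (G : sgraph) : connected_graph G -> forall e : edge G,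
  \sum_y dist y (pend e) + 2 = \sum_y dist y (mid e) + #|star_fractal G|.
Proof.
move=> cG e; have cH := star_fractal_connected cG.
transitivity (\sum_y (dist y (mid e) + 1)); last by rewrite big_split /= sum1_card.
rewrite (bigD1 (pend e)) //= [RHS](bigD1 (pend e)) //=.
have -> : dist (pend e) (mid e) = 1 by rewrite dist_pend // distxx.
rewrite distxx add0n addnC; congr (_ + _).
by apply: eq_bigr => y ye; rewrite (distC cH) dist_pend // (distC cH) addn1.
Qed.

(** This is [tree_edge_sum] summed over all roots. *)
Lemma edge_dist_total (G : sgraph) : is_tree G ->
  \sum_(e : edge G) \sum_(c in val e) \sum_v dist v c + #|G| * #|edge G| =
  4 * geodesic_distance G.
Proof.
move=> tG; have [cG _] := tG.
transitivity (\sum_w (\sum_(e : edge G) \sum_(c in val e) dist c w + #|edge G|)).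
  rewrite big_split sum_nat_const; congr (_ + _).
  rewrite [RHS]exchange_big; apply: eq_bigr => e _; rewrite [RHS]exchange_big /=.
  by apply: eq_bigr => c _; apply: eq_bigr => w _; rewrite distC.
rewrite (eq_bigr _ (fun w _ => tree_edge_sum tG w)) -big_distrr.
by rewrite exchange_big dist_total //= mulnA.
Qed.

Lemma old_rows (G : sgraph) : is_tree G ->
  \sum_(u : G) \sum_y dist y (old u) + #|G| * #|edge G| = 12 * geodesic_distance G.
Proof.
move=> tG; have [cG _] := tG.
rewrite -sum_nat_const -big_split /=.
rewrite -[12]/(6 * 2) -mulnA -dist_total //.
rewrite exchange_big big_distrr /=; apply: eq_bigr => u _.
rewrite row_star //; have := row_mid_sum tG u.
rewrite (eq_bigr _ (fun v _ => dist_old cG v u)) -big_distrr /=; lia.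
Qed.

(** Summing [dist_mid] over the inserted vertices as roots expresses their
    mutual distances through distances to old vertices, which
    [row_mid_sum] knows. *)
Lemma mid_rows (G : sgraph) : is_tree G ->
  \sum_(e : edge G) \sum_y dist y (mid e) + #|edge G| * #|edge G| + 2 * #|edge G| =
  3 * \sum_(e : edge G) \sum_(c in val e) \sum_v dist v c.
Proof.
move=> tG; have [cG _] := tG; have cH := star_fractal_connected cG.
set m := #|edge G|; set Q := (X in _ = 3 * X).
pose A := \sum_(e : edge G) \sum_u dist (old u) (mid e).
pose B := \sum_(e : edge G) \sum_f dist (mid f) (mid e).
have -> : \sum_(e : edge G) \sum_y dist y (mid e) = A + 2 * B + m * m.
  rewrite (eq_bigr _ (fun e _ => row_star cG (x := mid e) (fun=> isT))).
  by rewrite 2!big_split sum_nat_const /B [2 * _]big_distrr.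
have -> : A = Q.
  rewrite /A /Q; apply: eq_bigr => e _; rewrite [RHS]exchange_big; apply: eq_bigr => u _ /=.
  apply/eqP; rewrite -(eqn_pmul2l (isT : 0 < 2)) (distC cH) -[X in X == _]addn0.
  have := @dist_mid _ tG e (old u) isT; rewrite /= muln0 => ->.
  by rewrite big_distrr; apply/eqP/eq_bigr => c _; rewrite (dist_old cG) (distC cG).
(* It remains to evaluate the total B of the distances between inserted
   vertices, doubled so as to use the midpoint formula. *)
suff : 2 * B + 2 * m + 2 * m * m = 2 * Q by lia.
transitivity (\sum_(f : edge G) \sum_(c in val f) (\sum_e dist (mid e) (old c) + m)).
  have -> : 2 * B + 2 * m = \sum_(f : edge G) \sum_(c in val f) \sum_e dist (mid e) (old c).
    transitivity (\sum_(e : edge G) \sum_f (2 * dist (mid f) (mid e) + 2 * (mid e == mid f))).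
      rewrite /B !big_distrr -[2 * m]mulnC -sum_nat_const -big_split /=.
      apply: eq_bigr => e _; rewrite big_split -!big_distrr /=; congr (_ + _).
      rewrite (bigD1 e) //= eqxx big1 // => f fe; apply/eqP; rewrite eqb0.
      by apply: contraNneq fe => -[->].
    rewrite exchange_big; apply: eq_bigr => f _ /=; rewrite [RHS]exchange_big.
    apply: eq_bigr => e _; rewrite (dist_mid tG (x := mid e) isT).
    by apply: eq_bigr => c _; rewrite (distC cH).
  rewrite -[2 * m * m]mulnC -sum_nat_const -big_split; apply: eq_bigr => f _ /=.
  rewrite big_split sum_nat_const; have [a [b [_ ab ->]]] := edgeP f.
  by rewrite cards2 ab.
rewrite /Q big_distrr; apply: eq_bigr => f _; rewrite big_distrr.
by apply: eq_bigr => c _; exact: row_mid_sum.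
Qed.

Lemma pend_rows (G : sgraph) : connected_graph G ->
  \sum_(e : edge G) \sum_y dist y (pend e) + 2 * #|edge G| =
  \sum_(e : edge G) \sum_y dist y (mid e) + #|edge G| * #|star_fractal G|.
Proof.
move=> cG; rewrite [2 * _]mulnC.
transitivity (\sum_(e : edge G) (\sum_y dist y (pend e) + 2)).
  by rewrite big_split sum_nat_const.
by rewrite (eq_bigr _ (fun e _ => row_pend cG e)) big_split sum_nat_const.
Qed.

Lemma geodesic_distance_star (G : sgraph) : is_tree G ->
  geodesic_distance (star_fractal G) + 3 * #|edge G| ^ 2 + 6 * #|edge G| =
  18 * geodesic_distance G.
Proof.
move=> tG; have [cG mn] := tG; have cH := star_fractal_connected cG.
have cardG : #|G| = #|edge G|.+1.
  by have /card_gt0P[w _] := leq_ltn_trans (leq0n _) mn; apply: card_tree w tG.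
have := pend_rows cG; have := mid_rows tG; have := old_rows tG.
have := edge_dist_total tG; rewrite card_star cardG => eqQ eqO eqM eqP.
have := dist_total cH; rewrite exchange_big sum_star => /esym eqS.
have arith m S S' O M P Q : Q + m.+1 * m = 4 * S -> O + m.+1 * m = 12 * S ->
    M + m * m + 2 * m = 3 * Q -> P + 2 * m = M + m * (m.+1 + 2 * m) ->
    2 * S' = O + M + P -> S' + 3 * m ^ 2 + 6 * m = 18 * S.
  by rewrite -mulnn; lia.
exact: arith eqQ eqO eqM eqP eqS.
Qed.

(** * The T-graph *)

Lemma T_graph_tree (t : nat) : is_tree (T_graph t) /\ #|edge (T_graph t)| = 3 ^ t.
Proof.
elim: t => [|t [tG mt]]; last rewrite -[T_graph t.+1]/(star_fractal (T_graph t)).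
  have card_edge1 : #|edge single_edge| = 1.
    rewrite card_sig -(card1 [set: bool]); apply: eq_card => e; rewrite !inE.
    apply/existsP/eqP => [[x /existsP[y /andP[xy /eqP->]]]|->].
      by apply/setP => z; rewrite !inE; case: x y z xy => [] [] [].
    exists true; apply/existsP; exists false; rewrite /=.
    by apply/eqP/setP => -[]; rewrite !inE.
  split; last exact: card_edge1.
  by split; [exact: T_graph_connected | rewrite card_edge1 card_bool].
have tH := star_tree tG; split=> //.
have /card_gt0P[w _] := leq_ltn_trans (leq0n _) (proj2 tG).
have := card_tree (old w) tH; rewrite card_star (card_tree w tG) mt expnS; lia.
Qed.

(** The closed form multiplied by 15, which clears the denominators and also
    holds at t = 0, where the truncated exponent 2 * t - 1 would break it. *)
Lemma geodesic_distance_T_graph (t : nat) :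
  15 * geodesic_distance (T_graph t) =
  6 * 3 ^ t + (4 * 2 ^ t + 5) * (3 ^ t * 3 ^ t).
Proof.
elim: t => [|t IH]; last first.
  have [tG mt] := T_graph_tree t.
  have := geodesic_distance_star tG; rewrite -[star_fractal _]/(T_graph t.+1) mt !expnS expn0; nia.
have cE := @T_graph_connected 0; have := dist_total cE.
rewrite !big_bool /= !distxx (distC cE false true).
have -> : @dist single_edge true false = 1.
  apply/eqP; rewrite eqn_leq lt0n (dist_eq0 cE) andbT.
  exact: (@dist_adj single_edge).
by rewrite -/(T_graph 0); lia.
Qed.

Unset Implicit Arguments.
Local Open Scope ring_scope.
Import GRing.Theory.

Theorem corollary5 (t : nat) (ht : (1 <= t)%N) :
  (geodesic_distance (T_graph t))%:R =
    3 ^+ t + (2 ^+ (t + 2) + 5) / 5 * 3 ^+ (2 * t - 1) - 3 ^+ (t + 1) / 5 :> rat.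
Proof.
case: t ht => // t _.
have := congr1 (fun n => n%:R : rat) (geodesic_distance_T_graph t.+1).
rewrite /= !(natrD, natrM, natrX) !exprS => S15.
(* This splits the factor 9^(t+1) / 3 into powers with exponents t and 1. *)
have -> : (2 * t.+1 - 1 = t + t.+1)%N by lia.
rewrite !exprD !exprS expr0.
lra.
Qed.
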